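(* As $\gamma\to\infty$ (with $\gamma$ a real parameter, $\gamma\ge\gamma_0$), the process $(\hat Z^{(\gamma)},\hat U^{(\gamma)})$ converges strongly, i.e. almost surely, to $(Z,U)$ in Skorokhod's $J_1$-topology on the space of c\`adl\`ag functions from $[0,\infty)$ to $\mathcal{J}\times\mathbb{R}_+$ (where $\mathcal{J}$ carries the discrete topology and $\mathbb{R}_+$ the usual one).
   Context: $\mathcal{J}=\{1,\dots,J\}$ is a finite set. $\{\boldsymbol{\Lambda}(s,v)\}_{s,v\ge0}$ is a family of intensity matrices on $\mathcal{J}$ (nonnegative off-diagonal entries, zero row sums) such that $s\mapsto\boldsymbol{\Lambda}(s,v)$ is c\`adl\`ag for every $v\ge 0$, $v\mapsto\boldsymbol{\Lambda}(s,v)$ is c\`adl\`ag for every $s\ge 0$, and $\sup_{s,v\ge0,\,i\in\mathcal{J}}|\Lambda_{ii}(s,v)|\le\gamma_0$ for some $\gamma_0\in(0,\infty)$. Construction of the semi-Markov process $Z$ driven by $\boldsymbol{\Lambda}$ (started at $Z(0)=i$ with duration $0$). Let $\Gamma_0$ be a Poisson process of intensity $\gamma_0$ with arrival times $T_1<T_2<\cdots$ and $T_0=0$, independent of an i.i.d. sequence $\{Y_\ell\}_{\ell\ge1}$ of $\mathrm{Unif}(0,1)$ variables. Put $\zeta_0=i$, $\upsilon_0=0$ and recursively, with $P_\ell(k)=\delta_{\zeta_\ell,k}+\Lambda_{\zeta_\ell,k}(T_{\ell+1},\upsilon_\ell+(T_{\ell+1}-T_\ell))/\gamma_0$, set $\zeta_{\ell+1}=j$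 if $Y_{\ell+1}\in[\sum_{k<j}P_\ell(k),\sum_{k\le j}P_\ell(k))$; set $\upsilon_{\ell+1}=\upsilon_\ell+(T_{\ell+1}-T_\ell)$ if $\zeta_{\ell+1}=\zeta_\ell$ and $\upsilon_{\ell+1}=0$ otherwise. Then $Z(s)=\zeta_{\Gamma_0(s)}$, and its duration process is $U(t)=\inf\{r>0:Z(t-r)\neq Z(t)\}$ (with $U(t)=t$ if $Z$ has not changed state on $[0,t]$). Approximation. For each real $\gamma\ge\gamma_0$, on the same probability space, let $\Gamma'^{(\gamma)}$ be a Poisson process of intensity $\gamma-\gamma_0$ independent of $(\Gamma_0,\{Y_\ell\})$, let $\Gamma^{(\gamma)}=\Gamma_0+\Gamma'^{(\gamma)}$ be the superposition (a Poisson process of intensity $\gamma$) with arrival times $\chi^{(\gamma)}_1<\chi^{(\gamma)}_2<\cdots$ and $\chi^{(\gamma)}_0=0$, and let $\hat\Gamma^{(\gamma)}$ be a Poisson process of intensity $\gamma$ independent of $(\Gamma_0,\Gamma'^{(\gamma)},\{Y_\ell\})$. Put $\eta^{(\gamma)}_\ell=Z(\chi^{(\gamma)}_\ell)$ for $\ell\ge0$, $\hat Z^{(\gamma)}(s)=\eta^{(\gamma)}_{\hat\Gamma^{(\gamma)}(s)}$ for $s\ge0$, and let $\hat U^{(\gamma)}(t)=\inf\{r>0:\hat Z^{(\gamma)}(t-r)\ne\hat Z^{(\gamma)}(t)\}$ (with value $t$ if $\hat Z^{(\gamma)}$ has not changed state on $[0,t]$) be its duration process.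
   Formalization: The joint law over different γ is unspecified and the claim fails for some couplings; proved for real γ→∞ when Γ'^(γ)(t) and Γ̂^(γ)(t) are a.s. nondecreasing in γ, and for any coupling along sequences γ_n≥γ_0 with Σ exp(-cγ_n)<∞ for all c>0. *)

(* Defs.v *)
From HB Require Import structures.
From mathcomp Require Import all_boot all_order all_algebra.
From mathcomp Require Import all_classical all_reals all_analysis.

Set Implicit Arguments.
Unset Strict Implicit.
Unset Printing Implicit Defensive.

Import Order.TTheory GRing.Theory Num.Theory.
Import numFieldNormedType.Exports.

Local Open Scope classical_set_scope.
Local Open Scope ring_scope.

(* A path on [0, +oo[ with values in E is encoded as a function R -> E, of
   which only the values at nonnegative arguments are used. *)
Section skorokhod.
Context {R : realType}.

Definition cadlag {E : topologicalType} (f : R -> E) : Prop :=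
  (forall t, 0 <= t -> f x @[x --> t^'+] --> f t) /\
  (forall t, 0 < t -> exists l : E, f x @[x --> t^'-] --> l).

(* An increasing bijection of [0, +oo[ fixes 0 and is a homeomorphism. *)
Definition time_change (lam : R -> R) : Prop :=
  set_bij `[0, +oo[ `[0, +oo[ lam /\
  {in `[0, +oo[ &, {homo lam : s t / s < t}}.

(* As in the definition of the J1-topology by time changes (Jacod and Shiryaev,
   Theorem VI.1.14), x_n converges to x when there are time changes lam_n with
   sup_t |lam_n(t) - t| -> 0 and sup_(t <= T) d(x(t), x_n(lam_n(t))) -> 0 for
   all T. The sets J1_ball x T e form a base of neighbourhoods of x for it. *)
Definition J1_ball {E : pseudoMetricType R} (x : R -> E) (T e : R) :
    set (R -> E) :=
  [set y | cadlag y /\ exists lam : R -> R, [/\ time_change lam,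
    forall t, 0 <= t -> `|lam t - t| < e &
    forall t, 0 <= t <= T -> ball (x t) e (y (lam t))]].

Definition J1_nbhs {E : pseudoMetricType R} (x : R -> E) :
    set_system (R -> E) :=
  filter_from [set p : R * R | 0 < p.2] (fun p => J1_ball x p.1 p.2).

Definition J1_cvg {E : pseudoMetricType R} (F : set_system (R -> E))
    (x : R -> E) : Prop :=
  cadlag x /\ J1_nbhs x `<=` F.

End skorokhod.

Section probability.
Context {d : measure_display} {Om : measurableType d} {R : realType}.
Variable P : probability Om R.

Definition sigma_of {d'} {V : measurableType d'} {I : Type} (D : set I)
    (X : I -> Om -> V) : set (set Om) :=
  <<s \bigcup_(i in D) preimage_set_system setT (X i) measurable >>.

Definition independent_systems (F G : set (set Om)) : Prop :=
  forall A B, F A -> G B -> P (A `&` B) = (P A * P B)%E.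

Definition mutually_independent {d'} {V : measurableType d'} {I : choiceType}
    (X : I -> Om -> V) : Prop :=
  forall (s : seq I) (B : I -> set V), uniq s ->
    (forall k, measurable (B k)) ->
    P (\bigcap_(k in [set` s]) (X k @^-1` B k)) =
    (\prod_(k <- s) P (X k @^-1` B k))%E.

(* For rate > 0, it follows that almost surely the jumps have size 1 and the
   path is unbounded. The second argument of poisson_prob is a dummy. *)
Record poisson_process (rate : R) (N : R -> {RV P >-> nat}) : Prop := {
  poisson_process0 : forall w, N 0 w = 0%N ;
  poisson_process_ndecr : forall w s t, 0 <= s -> s <= t ->
    (N s w <= N t w)%N ;
  poisson_process_right_cont : forall w t, 0 <= t ->
    N s w @[s --> t^'+] --> N t w ;
  poisson_process_indep_incr : forall t : nat -> R, 0 <= t 0%N ->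
    {homo t : m n / (m <= n)%N >-> m <= n} ->
    mutually_independent (fun n w => (N (t n.+1) w - N (t n) w)%N) ;
  poisson_process_law : forall s t, 0 <= s -> s <= t -> forall A : set nat,
    P ((fun w => (N t w - N s w)%N) @^-1` A) =
    poisson_prob (rate * (t - s)) 0 A
}.

End probability.

Section construction.
Context {R : realType} {J : nat}.

(* Since N is nondecreasing and right-continuous, this is its n-th arrival
   time, with value 0 for n = 0. *)
Definition arrival (N : R -> nat) (n : nat) : R :=
  inf [set t | 0 <= t /\ (n <= N t)%N].

Definition intensity_matrix (L : 'M[R]_J) : Prop :=
  (forall i j, i != j -> 0 <= L i j) /\ (forall i, \sum_j L i j = 0).

(* The pair (zeta_n, upsilon_n); y n stands for the uniform variable Y_(n+1).
   The default value of odflt is only used for y n outside [0, 1[. *)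
Fixpoint sm_chain (Lam : R -> R -> 'M[R]_J) (gamma0 : R) (i : 'I_J)
    (T y : nat -> R) (n : nat) : 'I_J * R :=
  if n is m.+1 then
    let: (z, u) := sm_chain Lam gamma0 i T y m in
    let u' := u + (T m.+1 - T m) in
    let p k := (z == k)%:R + Lam (T m.+1) u' z k / gamma0 in
    let z' := odflt z [pick j : 'I_J |
      \sum_(k < J | (k < j)%N) p k <= y m < \sum_(k < J | (k <= j)%N) p k] in
    (z', if z' == z then u' else 0)
  else (i, 0).

Definition sm_path (Lam : R -> R -> 'M[R]_J) (gamma0 : R) (i : 'I_J)
    (N0 : R -> nat) (y : nat -> R) (s : R) : 'I_J :=
  (sm_chain Lam gamma0 i (arrival N0) y (N0 s)).1.

(* N is the grid process, Nhat the independent clock running on the grid. *)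
Definition approx_path (z : R -> 'I_J) (N Nhat : R -> nat) (s : R) : 'I_J :=
  z (arrival N (Nhat s)).

Definition duration (z : R -> 'I_J) (t : R) : R :=
  let A := [set r | [/\ 0 < r, r <= t & z (t - r) != z t]] in
  if `[< A !=set0 >] then inf A else t.

Definition with_duration (z : R -> 'I_J) (t : R) : discrete_topology 'I_J * R :=
  (z t, duration z t).

End construction.

(* Main.v *)
Require Import Defs.
From HB Require Import structures.
From mathcomp Require Import all_boot all_order all_algebra.
From mathcomp Require Import all_classical all_reals all_analysis.
From mathcomp Require Import ring lra.

Import Order.TTheory GRing.Theory Num.Theory.
Import numFieldNormedType.Exports.

Local Open Scope classical_set_scope.
Local Open Scope ring_scope.

(* Write Z = f o Gamma0, where Gamma0 is a counting path. Then the approximation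
   is Zhat = Z o a, where a(s) is the arrival time in the grid process of the
   point whose number is the value of the clock at s. By Chernoff's bound and the
   Borel-Cantelli lemma, the grid and clock counts on [0, t], divided by gamma,
   tend to t, uniformly on bounded intervals since they are nondecreasing; for a
   coupling that is monotone in gamma, the values gamma0 + n suffice. Hence a
   tends to the identity uniformly on bounded intervals. The rest is pathwise.
   Adding small tents to the identity yields a time change lam that sends every
   arrival time x of Gamma0 to the first passage of a above x, so that
   Zhat o lam = Z on [0, T]. Durations are determined by the sets of times at
   which the state differs from the current one; lam carries these sets for Z to
   those for Zhat and moves times by little, so the durations are close too. *)

(** * Time changes *)

Lemma seq_pos_lower_bound (R : realType) (s : seq R) :
  (forall x, x \in s -> 0 < x) ->
  exists2 r : R, 0 < r & forall x, x \in s -> r <= x.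
Proof.
elim: s => [|x s IHs] s_gt0; first by exists 1.
have [y ys|r r_gt0 rs] := IHs; first by rewrite s_gt0 // inE ys orbT.
exists (Num.min x r); first by rewrite lt_min s_gt0 ?inE ?eqxx.
move=> y; rewrite inE => /predU1P[->|/rs ry]; first by rewrite ge_min lexx.
by rewrite ge_min ry orbT.
Qed.

Lemma seq_separated (R : realType) (s : seq R) :
  exists2 r : R, 0 < r &
    forall x y, x \in s -> y \in s -> x != y -> r <= `|x - y|.
Proof.
pose dist := [seq q <- [seq `|x - y| | x <- s, y <- s] | 0 < q].
have [q|r r_gt0 r_le] := @seq_pos_lower_bound R dist.
  by rewrite mem_filter => /andP[].
exists r => // x y xs ys xNy; apply: r_le.
by rewrite mem_filter normr_gt0 subr_eq0 xNy; exact: allpairs_f.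
Qed.

Section bump.
Context {R : realType}.
Implicit Types r x y s t : R.

Definition bump r x t : R := Num.max 0 (1 - `|t - x| / r).

Lemma bump_center r x : bump r x x = 1.
Proof. by rewrite /bump subrr normr0 mul0r subr0; apply/max_idPr. Qed.

Lemma bump_far r x t : 0 < r -> r <= `|t - x| -> bump r x t = 0.
Proof.
move=> r_gt0 rt; apply/max_idPl; rewrite subr_le0.
by rewrite ler_pdivlMr // mul1r.
Qed.

Lemma bump_bounded r x t : 0 < r -> `|bump r x t| <= 1.
Proof.
move=> r_gt0; rewrite ger0_norm ?le_max ?lexx // ge_max ler01 /=.
by rewrite gerBl divr_ge0 // ltW.
Qed.

Lemma bump_lipschitz r x s t : 0 < r ->
  `|bump r x s - bump r x t| <= `|s - t| / r.
Proof.
move=> r_gt0.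
have lip : `|(`|s - x| / r) - (`|t - x| / r)| <= `|s - t| / r.
  rewrite -mulrBl normrM [`|r^-1|]gtr0_norm ?invr_gt0 // ler_pM2r ?invr_gt0 //.
  by apply: le_trans (ler_dist_dist _ _) _; rewrite opprB addrA subrK.
have : 0 <= `|s - t| / r by rewrite divr_ge0 // ltW.
move: lip; rewrite /bump; move: (`|s - t| / r) => p.
move: (`|s - x| / r) (`|t - x| / r) => q q'; rewrite !ler_norml.
by case: (leP 0 (1 - q)) => ?; case: (leP 0 (1 - q')) => ?; lra.
Qed.

End bump.

(** The slope bound 1/2 makes [t + h t] continuous and strictly increasing; as [h] is bounded, the
    intermediate value theorem on [[0, y + e]] gives surjectivity. *)
Lemma lipschitz_time_change (R : realType) (h : R -> R) (e : R) : h 0 = 0 ->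
  (forall t, `|h t| <= e) ->
  (forall s t, `|h s - h t| <= `|s - t| / 2) ->
  time_change (fun t => t + h t).
Proof.
move=> h0 h_le h_lip; pose lam t := t + h t.
have lam_mono s t : s < t -> lam s < lam t.
  move=> st; have := h_lip t s; rewrite /lam ler_norml gtr0_norm ?subr_gt0 //.
  by lra.
have lam_cont : continuous lam.
  move=> t; apply/cvgrPdist_le => /= eps eps_gt0.
  exists (eps / 2) => /= [|s /= ts]; first by rewrite divr_gt0.
  have := h_lip t s; move: ts; rewrite /lam => ts hts.
  have -> : t + h t - (s + h s) = (t - s) + (h t - h s) by lra.
  by apply: le_trans (ler_normD _ _) _; move: ts hts; lra.
have lam_ge0 t : 0 <= t -> 0 <= lam t.
  rewrite le_eqVlt => /predU1P[<-|/lam_mono/ltW]; rewrite /lam h0 ?addr0 //.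
split; last by move=> s t _ _; exact: lam_mono.
split.
- by move=> t /=; rewrite !in_itv /= !andbT; exact: lam_ge0.
- move=> s t _ _ st; apply/eqP; apply: contraT.
  by rewrite neq_lt => /orP[] /lam_mono; rewrite /lam st ltxx.
- move=> y /=; rewrite in_itv /= andbT => y_ge0.
  have e_ge0 : 0 <= e by rewrite (le_trans _ (h_le 0)).
  have [] := @IVT R lam 0 (y + e) y.
  + by rewrite addr_ge0.
  + exact: continuous_subspaceT.
  + rewrite ge_min le_max /lam h0 addr0 y_ge0 /=.
    by apply/orP; right; have := h_le (y + e); rewrite ler_norml; lra.
  move=> t; rewrite in_itv /= => /andP[t_ge0 _] lamt.
  by exists t => //=; rewrite in_itv /= t_ge0.
Qed.

(** A tent of height [sigma x - x] is added to the identity at each [x] in [s]. The tolerance [del]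
    is fixed before [sigma], so one value serves all approximations. *)
Lemma time_change_interpolation (R : realType) (s : seq R) (e : R) :
  0 < e -> 0 \in s ->
  exists2 del : R, 0 < del & forall sigma : R -> R, sigma 0 = 0 ->
    (forall x, x \in s -> `|sigma x - x| <= del) ->
    exists lam, [/\ time_change lam, forall t, 0 <= t -> `|lam t - t| < e &
      forall x, x \in s -> lam x = sigma x].
Proof.
move=> e_gt0 s0; have [r r_gt0 r_sep] := seq_separated R s.
pose n : R := (size (undup s)).+1%:R.
have n_gt0 : 0 < n by rewrite ltr0n.
(* As [n] exceeds the number of tents, the heights total at most [Num.min e r / 2]: the bound by [e]
   controls the displacement, the bound by [r] offsets the tent slope [1 / r] and leaves slope
   1/2. *)
exists (Num.min e r / 2 / n); first by rewrite !divr_gt0 // lt_min e_gt0.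
set del := (_ / n) => sigma sigma0 sigma_near.
pose h t := \sum_(x <- undup s) (sigma x - x) * bump r x t.
have sum_le (f : R -> R) (q : R) : 0 <= q -> (forall x, `|f x| <= q) ->
    `|\sum_(x <- undup s) (sigma x - x) * f x| <= Num.min e r / 2 * q.
  move=> q_ge0 f_le; apply: le_trans (ler_norm_sum _ _ _) _.
  apply: (@le_trans _ _ (\sum_(x <- undup s) del * q)).
    rewrite big_seq [leRHS]big_seq; apply: ler_sum => x.
    by rewrite mem_undup => xs; rewrite normrM ler_pM ?sigma_near.
  rewrite big_const_seq count_predT iter_addr addr0 -[leLHS]mulr_natl mulrA.
  rewrite ler_wpM2r // mulrCA ler_piMr //.
    by rewrite divr_ge0 // le_min !ltW.
  by rewrite ler_pdivrMr // mul1r ler_nat.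
have h_at x : x \in s -> h x = sigma x - x.
  move=> xs; rewrite /h (bigD1_seq x) ?mem_undup ?undup_uniq //=.
  rewrite bump_center mulr1 big_seq_cond big1 ?addr0 // => y /andP[].
  by rewrite mem_undup => ys yx; rewrite bump_far ?mulr0 // r_sep // eq_sym.
have h_le t : `|h t| <= e / 2.
  apply: le_trans (sum_le (bump r ^~ t) 1 _ _) _ => // [x|].
    exact: bump_bounded.
  by rewrite mulr1 ler_wpM2r // ge_min lexx.
exists (fun t => t + h t); split.
- apply: (@lipschitz_time_change _ _ (e / 2)) => //.
    by rewrite h_at // sigma0 subrr.
  move=> u v; rewrite /h -sumrB; under eq_bigr do rewrite -mulrBr.
  apply: le_trans (sum_le (fun x => bump r x u - bump r x v)
    (`|u - v| / r) _ _) _.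
  + by rewrite divr_ge0 // ltW.
  + by move=> x; exact: bump_lipschitz.
  rewrite [_ / r]mulrC mulrACA [2^-1 * _]mulrC ler_piMl ?divr_ge0 //.
  by rewrite ler_pdivrMr // mul1r ge_min lexx orbT.
- by move=> t _; rewrite addrAC subrr add0r (le_lt_trans (h_le t)) //; lra.
- by move=> x /h_at ->; rewrite addrC subrK.
Qed.

(** * Matching a counting path with its image under a clock *)

Section first_passage.
Context {R : realType}.

(** The last hypothesis carries [Q] from times just after [s] back to [s], so the infimum is
    attained. *)
Lemma first_passageP (Q : R -> Prop) (T : R) : 0 <= T -> Q T ->
  (forall s t, 0 <= s -> s <= t -> t <= T -> Q s -> Q t) ->
  (forall s, 0 <= s -> s < T ->
    exists2 e : R, 0 < e & forall t, s <= t < s + e -> Q t -> Q s) ->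
  forall t, 0 <= t <= T -> Q t <-> inf [set s | 0 <= s /\ Q s] <= t.
Proof.
move=> T_ge0 QT Q_up Q_right t /andP[t_ge0 t_le].
set A := [set s | _].
have A_inf : has_inf A by split; [exists T|exists 0 => s []].
split=> [Qt|]; first by apply: ge_inf => //; exact: A_inf.2.
rewrite le_eqVlt => /predU1P[infE|]; last first.
  move=> /(inf_lt A_inf.1)[s [s_ge0 Qs] st].
  by apply: Q_up Qs => //; exact: ltW.
move: t_le; rewrite le_eqVlt => /predU1P[-> //|tT].
have [e e_gt0 tP] := Q_right t t_ge0 tT.
have [s As ste] : exists2 s, A s & s < inf A + e.
  by apply: inf_lt; [exact: A_inf.1|rewrite ltrDl].
have ts : t <= s by rewrite -infE; apply: ge_inf => //; exact: A_inf.2.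
by case: As => s_ge0 /(tP s); apply; rewrite ts -infE.
Qed.

(** Unlike right continuity, this survives composition with any function, so it covers both counting
    paths and the real-valued step clock. *)
Definition right_constant {E : Type} (f : R -> E) : Prop :=
  forall s, 0 <= s ->
    exists2 e : R, 0 < e & forall t, s <= t < s + e -> f t = f s.

Definition counting_path (c : R -> nat) : Prop :=
  (forall s t, 0 <= s -> s <= t -> (c s <= c t)%N) /\ right_constant c.

Lemma right_constant_comp {E E' : Type} (F : E -> E') (f : R -> E) :
  right_constant f -> right_constant (F \o f).
Proof.
move=> f_right s /f_right[e e_gt0 fe]; exists e => // t /fe.
by rewrite /= => ->.
Qed.

(** Level [n] has to be reached by time [T]: the infimum of an empty set would be the default 0. *)
Lemma arrivalP (c : R -> nat) (T : R) (n : nat) : counting_path c ->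
  0 <= T -> (n <= c T)%N -> forall t, 0 <= t <= T ->
  (n <= c t)%N = (arrival c n <= t).
Proof.
move=> [c_ndecr c_right] T_ge0 nT t tT.
have [le_c le_t] : (n <= c t)%N <-> arrival c n <= t.
  apply: (@first_passageP (fun s => n <= c s)%N T) => //.
    by move=> s u s_ge0 su _ ns; rewrite (leq_trans ns) ?c_ndecr.
  move=> s s_ge0 _; have [e e_gt0 ce] := c_right s s_ge0.
  by exists e => // u /ce ->.
exact/idP/idP.
Qed.

End first_passage.

Section matching.
Context {R : realType}.

(* Matching each arrival time x of c with the first passage of a above x makes
   c \o a a time-changed copy of c. *)
Lemma counting_path_match (c : R -> nat) (T e : R) :
  counting_path c -> 0 <= T -> 0 < e ->
  exists2 del : R, 0 < del & forall a : R -> R,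
    (forall s t, 0 <= s -> s <= t -> t <= T + 3 -> a s <= a t) ->
    right_constant a ->
    (forall t, 0 <= t <= T + 3 -> 0 <= a t) ->
    (forall t, 0 <= t <= T + 3 -> `|a t - t| <= del) ->
    exists lam, [/\ time_change lam, forall t, 0 <= t -> `|lam t - t| < e &
      forall t, 0 <= t <= T -> c (a (lam t)) = c t].
Proof.
move=> c_counting T_ge0 e_gt0.
(* The margins nest: [lam] moves times by less than 1, so [lam t] is at most [T + 1]; [a] moves them
   by at most 1, so [a (lam t)] is at most [T + 2]; and [a] has reached [T + 2] by time [T + 3]. *)
pose times := 0 :: [seq arrival c n | n <- iota 0 (c (T + 2)).+1].
have e1_gt0 : 0 < Num.min e 1 by rewrite lt_min e_gt0 ltr01.
have [del del_gt0 interp] :=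
  @time_change_interpolation R times _ e1_gt0 (mem_head _ _).
exists (Num.min del 1) => [|a a_ndecr a_right a_ge0 a_near].
  by rewrite lt_min del_gt0 ltr01.
pose sigma x := inf [set s | 0 <= s /\ x <= a s].
have T2_ge0 : 0 <= T + 2 by lra.
have T3_ge0 : 0 <= T + 3 by lra.
have a_T3 : T + 2 <= a (T + 3).
  have := a_near (T + 3); rewrite lexx T3_ge0 => /(_ isT).
  by rewrite le_min ler_norml => /andP[_]; rewrite ler_norml; lra.
have sigmaP x u : x <= T + 2 -> 0 <= u <= T + 3 -> (x <= a u) = (sigma x <= u).
  move=> x_le u_bound.
  have [le_a le_u] : x <= a u <-> sigma x <= u.
    apply: (@first_passageP R (fun s => x <= a s) (T + 3)) => //.
    - exact: le_trans a_T3.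
    - by move=> s t s_ge0 st t_le /le_trans; apply; exact: a_ndecr.
    - move=> s s_ge0 _; have [r r_gt0 ar] := a_right s s_ge0.
      by exists r => // t /ar ->.
  exact/idP/idP.
have times_bound x : x \in times -> 0 <= x <= T + 2.
  rewrite inE => /predU1P[->|/mapP[n]]; first by rewrite lexx.
  rewrite mem_iota add0n ltnS => /andP[_ n_le] ->.
  rewrite -(@arrivalP _ c (T + 2)) // ?T2_ge0 ?lexx // n_le andbT.
  by apply: lb_le_inf; [exists (T + 2)|move=> s []].
have sigma_ge0 x : x <= T + 2 -> 0 <= sigma x.
  move=> x_le; apply: lb_le_inf; last by move=> s [].
  by exists (T + 3); split=> //; rewrite (le_trans x_le).
have sigma0 : sigma 0 = 0.
  apply/eqP; rewrite eq_le sigma_ge0 // andbT.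
  by rewrite -sigmaP ?a_ge0 // lexx.
have [x /times_bound/andP[x_ge0 x_le]|lam [lam_tc lam_near lamE]] :=
    interp sigma sigma0.
  have sigma_T3 : sigma x <= T + 3.
    by rewrite -sigmaP ?lexx ?T3_ge0 ?(le_trans x_le).
  have sigma_bound : 0 <= sigma x <= T + 3 by rewrite sigma_ge0.
  have := a_near (sigma x) sigma_bound.
  have : x <= a (sigma x) by rewrite sigmaP // ?sigma_ge0 ?lexx.
  rewrite le_min => x_a /andP[near_sigma near_sigma1].
  (* At time [u] the clock [a] is at least [x], which bounds [sigma x] above; [x <= a (sigma x)]
     bounds it below. *)
  pose u := x + Num.min del 1.
  have min_gt0 : 0 < Num.min del 1 by rewrite lt_min del_gt0 ltr01.
  have min_le : Num.min del 1 <= 1 by rewrite ge_min lexx orbT.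
  have min_del : Num.min del 1 <= del by rewrite ge_min lexx.
  have u_bound : 0 <= u <= T + 3 by rewrite /u; lra.
  have : sigma x <= u.
    rewrite -sigmaP //; have := a_near u u_bound.
    by rewrite ler_norml /u; lra.
  by move: near_sigma; rewrite /u !ler_norml; lra.
have lam_lt1 t : 0 <= t -> `|lam t - t| < 1 /\ `|lam t - t| < e.
  by move=> /lam_near; rewrite lt_min => /andP[].
exists lam; split=> // [t /lam_lt1[]//|t /andP[t_ge0 t_le]].
have lam_ge0 : 0 <= lam t.
  by have [[/(_ t) + _ _] _] := lam_tc; rewrite /= !in_itv /= !andbT; exact.
have lam_le : lam t <= T + 1.
  by have := (lam_lt1 t t_ge0).1; rewrite ltr_norml; lra.
have lam_bound : 0 <= lam t <= T + 3 by rewrite lam_ge0; lra.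
have a_bound : 0 <= a (lam t) <= T + 2.
  rewrite a_ge0 //=; have := a_near _ lam_bound; rewrite le_min => /andP[_].
  by rewrite ler_norml; lra.
have t_bound : 0 <= t <= T + 2 by rewrite t_ge0; lra.
(* Both counts are compared level by level. For a level with arrival time [x], [x <= a (lam t)]
   means [lam x = sigma x <= lam t], that is [x <= t]; levels above [c (T + 2)] are reached on
   neither side. *)
have c_le n : (n <= c (a (lam t)))%N = (n <= c t)%N.
  have [n_le|n_gt] := leqP n (c (T + 2)); last first.
    have c_T2 s : 0 <= s <= T + 2 -> (n <= c s)%N = false.
      move=> /andP[s_ge0 s_le]; apply/negbTE; rewrite -ltnNge.
      by apply: leq_ltn_trans n_gt; exact: c_counting.1.
    by rewrite !c_T2.
  have arrE := @arrivalP _ c (T + 2) n c_counting T2_ge0 n_le.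
  rewrite (arrE _ a_bound) (arrE _ t_bound); set x := arrival c n.
  have x_times : x \in times.
    by rewrite inE; apply/orP; right; apply: map_f; rewrite mem_iota.
  have /andP[x_ge0 x_le] := times_bound x x_times.
  rewrite sigmaP // -lamE //.
  have [_ lam_mono] := lam_tc.
  have [tx|xt|->] := ltgtP t x; last by rewrite lexx.
  - by apply/negbTE; rewrite -ltNge lam_mono // in_itv /= andbT.
  - by apply/ltW/lam_mono; rewrite ?in_itv /= ?andbT.
by apply/eqP; rewrite eqn_leq -c_le leqnn /= c_le.
Qed.

End matching.

(** * Durations *)

Section duration.
Context {R : realType} {J : nat}.
Implicit Types (z : R -> 'I_J) (r s t u : R).

Lemma inf_le_shift (A B : set R) (q : R) : A !=set0 -> has_lbound B ->
  (forall r, A r -> exists2 r', B r' & r' <= r + q) -> inf B <= inf A + q.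
Proof.
move=> A_neq0 B_lb AB; rewrite -lerBlDr; apply: lb_le_inf => // r.
move=> /AB[r' Br' r'r]; rewrite lerBlDr; apply: le_trans r'r; exact: ge_inf.
Qed.

(** The last two hypotheses make the two sets of lags empty together, so infima are compared with
    infima and the default [t'] with the default [t]. *)
Lemma duration_le_shift z z' t t' q : t' <= t + q ->
  (forall r, [/\ 0 < r, r <= t & z (t - r) != z t] ->
    exists2 r', [/\ 0 < r', r' <= t' & z' (t' - r') != z' t'] & r' <= r + q) ->
  (forall r', [/\ 0 < r', r' <= t' & z' (t' - r') != z' t'] ->
    exists r, [/\ 0 < r, r <= t & z (t - r) != z t]) ->
  duration z' t' <= duration z t + q.
Proof.
move=> t't zz' z'z; rewrite /duration.
case: asboolP => [[r' Br']|B0]; case: asboolP => [[r Ar]|A0] //.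
- apply: inf_le_shift => //; first by exists r.
  by exists 0 => s [/ltW].
- by case: A0; exact: z'z Br'.
- by case: B0; have [s Bs _] := zz' r Ar; exists s.
Qed.

(** While the state is frozen, every lag to a different state grows at unit speed, and so does the
    default value. *)
Lemma duration_shift z s u : 0 <= s -> s <= u ->
  (forall t, s <= t <= u -> z t = z s) ->
  duration z u = duration z s + (u - s).
Proof.
move=> s_ge0 su z_const.
have zu : z u = z s by rewrite z_const // su lexx.
have up r : [/\ 0 < r, r <= s & z (s - r) != z s] ->
    [/\ 0 < r + (u - s), r + (u - s) <= u & z (u - (r + (u - s))) != z u].
  move=> [r_gt0 rs zr]; split; [lra|lra|].
  by rewrite (_ : u - _ = s - r) ?zu //; lra.
have down r : [/\ 0 < r, r <= u & z (u - r) != z u] ->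
    [/\ 0 < r - (u - s), r - (u - s) <= s & z (s - (r - (u - s))) != z s].
  move=> [r_gt0 ru zr].
  have ur : u - r < s.
    rewrite ltNge; apply: contra zr => sur.
    by rewrite z_const ?zu // sur /=; lra.
  split; [lra|lra|].
  by rewrite (_ : s - _ = u - r) -?zu //; lra.
apply/eqP; rewrite eq_le; apply/andP; split.
- apply: duration_le_shift; first by lra.
    by move=> r /up; exists (r + (u - s)).
  by move=> r /down; exists (r - (u - s)).
- rewrite -lerBrDr; apply: duration_le_shift; first by lra.
    by move=> r /down; exists (r - (u - s)).
  by move=> r /up; exists (r + (u - s)).
Qed.

(** A lag is a difference of two times, each moved by at most [e]; hence the factor 2. Lags are
    pushed forward by [lam] and pulled back by its surjectivity. *)
Lemma duration_time_change z z' (lam : R -> R) (T e : R) : time_change lam ->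
  (forall t, 0 <= t -> `|lam t - t| <= e) ->
  (forall t, 0 <= t <= T -> z' (lam t) = z t) ->
  forall t, 0 <= t <= T -> `|duration z t - duration z' (lam t)| <= 2 * e.
Proof.
move=> [[lam_maps _ lam_surj] lam_mono] lam_near zz' t /andP[t_ge0 t_le].
have lam_ge0 s : 0 <= s -> 0 <= lam s.
  by have := lam_maps s; rewrite /= !in_itv /= !andbT.
have lam_lt s u : 0 <= s -> s < u -> lam s < lam u.
  move=> s_ge0 su; apply: lam_mono => //; rewrite in_itv /= andbT //.
  exact: le_trans (ltW su).
have z't : z' (lam t) = z t by rewrite zz' // t_ge0.
have push r : [/\ 0 < r, r <= t & z (t - r) != z t] ->
    exists2 r', [/\ 0 < r', r' <= lam t & z' (lam t - r') != z' (lam t)] &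
      r - 2 * e <= r' <= r + 2 * e.
  move=> [r_gt0 rt zr]; have tr_ge0 : 0 <= t - r by lra.
  have := lam_near _ tr_ge0; have := lam_near _ t_ge0; have := lam_ge0 _ tr_ge0.
  have := lam_lt (t - r) t tr_ge0; rewrite gtrBl => /(_ r_gt0) lt_lam le_lam.
  rewrite !ler_norml => /andP[? ?] /andP[? ?].
  exists (lam t - lam (t - r)); last by apply/andP; split; lra.
  split; [lra|lra|].
  by rewrite subKr z't zz' // tr_ge0 /=; lra.
have pull r' : [/\ 0 < r', r' <= lam t & z' (lam t - r') != z' (lam t)] ->
    exists2 r, [/\ 0 < r, r <= t & z (t - r) != z t] &
      r' - 2 * e <= r <= r' + 2 * e.
  move=> [r'_gt0 r't z'r'].
  have [|u] := lam_surj (lam t - r'); first by rewrite /= in_itv /= andbT; lra.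
  rewrite /= in_itv /= andbT => u_ge0 lamu.
  have ut : u < t.
    rewrite ltNge le_eqVlt; apply/negP => /predU1P[tu|/(lam_lt _ _ t_ge0)].
      by move: lamu; rewrite -tu; lra.
    by rewrite lamu; lra.
  have := lam_near _ u_ge0; have := lam_near _ t_ge0; rewrite lamu !ler_norml.
  move=> /andP[? ?] /andP[? ?].
  exists (t - u); last by apply/andP; split; lra.
  split; [lra|lra|].
  rewrite subKr -zz' ?u_ge0 /=; last by lra.
  by rewrite lamu -z't.
have := lam_near _ t_ge0; have := lam_near 0 (lexx 0).
have := lam_ge0 _ t_ge0; rewrite !ler_norml => ? /andP[? ?] /andP[? ?].
have : duration z' (lam t) <= duration z t + 2 * e.
  apply: duration_le_shift; first by lra.
    by move=> r /push[r' ? /andP[? ?]]; exists r'.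
  by move=> r' /pull[r ? _]; exists r.
have : duration z t <= duration z' (lam t) + 2 * e.
  apply: duration_le_shift; first by lra.
    by move=> r' /pull[r ? /andP[? ?]]; exists r.
  by move=> r /push[r' ? _]; exists r'.
by lra.
Qed.

(** The general filter serves twice: [x = s] gives right continuity, and [s] in the last interval of
    constancy before [x] gives the left limit. *)
Lemma with_duration_cvg (F : set_system R) {FF : Filter F} z s x :
  0 <= s -> u @[u --> F] --> x ->
  (\forall u \near F, s <= u /\ forall t, s <= t <= u -> z t = z s) ->
  with_duration z u @[u --> F] -->
    (z s : discrete_topology 'I_J, duration z s + (x - s)).
Proof.
move=> s_ge0 Fx z_const.
have ramp : {near F,
    (fun u => (z s : discrete_topology 'I_J, duration z s + (u - s))) =1
    with_duration z}.
  apply: filterS z_const => u [su z_const]; rewrite /with_duration.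
  by rewrite (duration_shift z s u) // (z_const u) // su lexx.
apply: cvg_trans (near_eq_cvg ramp) _.
have state_cvg : (z s : discrete_topology 'I_J) @[_ --> F] -->
    (z s : discrete_topology 'I_J) by exact: cvg_cst.
have duration_cvg :
    duration z s + (u - s) @[u --> F] --> duration z s + (x - s).
  by apply: cvgD; [exact: cvg_cst|apply: cvgB => //; exact: cvg_cst].
exact: cvg_pair state_cvg duration_cvg.
Qed.

(** Induction on the remaining increase [c t - c s]: if [c] is not constant from [s] on, restarting
    after a jump lowers it. *)
Lemma counting_path_left_constant (c : R -> nat) t : counting_path c ->
  0 < t -> exists2 s, 0 <= s < t & forall u, s <= u < t -> c u = c s.
Proof.
move=> [c_ndecr _] t_gt0.
suff gen n s : (c t - c s <= n)%N -> 0 <= s < t ->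
    exists2 s, 0 <= s < t & forall u, s <= u < t -> c u = c s.
  by apply: (gen _ 0%R (leqnn _)); rewrite lexx.
elim: n s => [|n IHn] s c_le /andP[s_ge0 st].
  exists s; rewrite ?s_ge0 // => u /andP[su ut].
  have := c_ndecr _ _ s_ge0 su.
  have := c_ndecr u t (le_trans s_ge0 su) (ltW ut).
  move: c_le; rewrite leqn0 subn_eq0 => ct c_ut c_su.
  by apply/eqP; rewrite eqn_leq c_su (leq_trans c_ut).
have [c_const|] := pselect (forall u, s <= u < t -> c u = c s).
  by exists s => //; rewrite s_ge0.
move=> /existsNP[u /not_implyP[/andP[su ut] cu]].
have u_ge0 : 0 <= u := le_trans s_ge0 su.
apply: (IHn u); last by rewrite u_ge0.
have := c_ndecr _ _ s_ge0 su; rewrite leq_eqVlt => /predU1P[/esym //|cs].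
rewrite leq_subLR -ltnS; apply: leq_ltn_trans (_ : c s + n.+1 < _)%N.
  by rewrite -leq_subLR.
by rewrite addnS ltnS -addSn leq_add2r.
Qed.

Lemma with_duration_cadlag (c : R -> nat) (f : nat -> 'I_J) :
  counting_path c -> cadlag (with_duration (f \o c)).
Proof.
move=> c_counting; split=> t.
  move=> t_ge0; have [e e_gt0 ce] := c_counting.2 t t_ge0.
  have -> : with_duration (f \o c) t =
      (f (c t) : discrete_topology 'I_J, duration (f \o c) t + (t - t)).
    by rewrite subrr addr0.
  apply: with_duration_cvg => //; first exact: cvg_at_right_filter.
  near=> u; split=> [|v /andP[tv vu]]; first by near: u; exact: nbhs_right_ge.
  rewrite /= ce // tv (le_lt_trans vu) //; near: u; apply: nbhs_right_lt.
  by rewrite ltrDl.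
move=> /(counting_path_left_constant _ _ c_counting)[s /andP[s_ge0 st] cs].
eexists; apply: (@with_duration_cvg _ _ _ s t) => //.
  exact: cvg_at_left_filter.
near=> u; split=> [|v /andP[sv vu]]; first by near: u; exact: nbhs_left_ge.
rewrite /= cs // sv (le_lt_trans vu) //; near: u; exact: nbhs_left_lt.
Unshelve. all: by end_near. Qed.

End duration.

(** * Law of large numbers for Poisson processes *)

Lemma poisson_probE (R : realType) (r : R) k (A : set nat) : 0 < r ->
  poisson_prob r k A = (\sum_(n <oo | n \in A) (poisson_pmf r n)%:E)%E.
Proof.
move=> r_gt0; rewrite /poisson_prob r_gt0 nneseries_esum ?set_mem_set // => n _.
by rewrite lee_fin poisson_pmf_ge0.
Qed.

(** Exponential tilting turns a Poisson law into another one, up to the moment generating function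
    [expR (r * (expR theta - 1))]. *)
Lemma poisson_pmf_tilt (R : realType) (r theta : R) n : 0 < r ->
  expR (theta * n%:R) * poisson_pmf r n =
  expR (r * (expR theta - 1)) * poisson_pmf (r * expR theta) n.
Proof.
move=> r_gt0; rewrite /poisson_pmf r_gt0 mulr_gt0 ?expR_gt0 //.
rewrite exprMn expRM_natr.
have -> : expR (- r) = expR (r * (expR theta - 1)) * expR (- (r * expR theta)).
  by rewrite -expRD; congr expR; ring.
by ring.
Qed.

(* A positive theta bounds the upper tail, a negative one the lower tail. *)
Lemma poisson_chernoff (R : realType) (r theta x : R) (A : set nat) : 0 <= r ->
  (forall n, A n -> theta * x <= theta * n%:R) ->
  (poisson_prob r 0 A <= (expR (r * (expR theta - 1) - theta * x))%:E)%E.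
Proof.
(* At rate 0 the law is the Dirac mass at 0; if [A] contains 0, then [theta * x <= 0] and the bound
   is at least 1. *)
rewrite le_eqVlt => /predU1P[<- A_le|r_gt0 A_le].
  rewrite /poisson_prob ltxx mul0r sub0r diracE; case: (boolP (0%N \in A)).
    rewrite inE => /A_le; rewrite mulr0 lee_fin => thetax_le0 /=.
    by apply: le_trans (expR_ge1Dx _); lra.
  by rewrite lee_fin expR_ge0.
pose q := r * expR theta.
have q_gt0 : 0 < q by rewrite mulr_gt0 ?expR_gt0.
pose C := expR (r * (expR theta - 1) - theta * x).
(* Comparison with the tilted law, whose mass is at most 1, replaces the summation of the
   exponential moment. *)
apply: (@le_trans _ _ (C%:E * poisson_prob q 0 A)%E); last first.
  rewrite -[leRHS]mule1 lee_wpmul2l ?lee_fin ?expR_ge0 //.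
  exact: probability_le1.
rewrite !poisson_probE // -nneseriesZl; last first.
  by move=> n _; rewrite lee_fin poisson_pmf_ge0.
apply: lee_nneseries => [n _ _|n]; first by rewrite lee_fin poisson_pmf_ge0.
rewrite inE => /A_le An; rewrite -EFinM lee_fin /C expRD mulrAC.
rewrite -poisson_pmf_tilt // mulrAC -expRD ler_peMl ?poisson_pmf_ge0 //.
by apply: le_trans (expR_ge1Dx _); lra.
Qed.

(** From [expR (- x) >= 1 - x] one gets [expR x <= 1 / (1 - x)], which is at most the right-hand
    side on this range. *)
Lemma expR_quadratic_bound (R : realType) (x : R) : `|x| <= 2^-1 ->
  expR x <= 1 + x + 2 * x ^+ 2.
Proof.
rewrite ler_norml => /andP[x_ge x_le].
have := expR_ge1Dx (- x); have := expRxMexpNx_1 x; have := expR_gt0 x.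
set y := expR x; set y' := expR (- x) => y_gt0 yy' y'_ge.
by nra.
Qed.

Section poisson_deviation.
Context {d : measure_display} {Om : measurableType d} {R : realType}.
Variable P : probability Om R.

(** The offset [a] treats rates [g - gamma0] and [g] together, both centered at [g * t]; it costs
    the factor [expR (a * t)]. The exponent [c] is uniform in [g]. *)
Lemma poisson_process_deviation (a t e : R) : 0 <= a -> 0 <= t -> 0 < e ->
  exists2 c : R, 0 < c & forall (g : R) (N : R -> {RV P >-> nat}), a <= g ->
    poisson_process (g - a) N ->
    (P [set w | (e * g < `|(N t w)%:R - g * t|)%R] <=
      (2 * expR (a * t) * expR (- c * g))%:E)%E.
Proof.
move=> a_ge0 t_ge0 e_gt0.
(* The value 1/2 allows the quadratic bound on [expR]; the other one gives [4 * t * th <= e], so the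
   quadratic term uses at most half of the gain [th * e * g]. *)
pose th := Num.min 2^-1 (e / (4 * (t + 1))).
have t1_gt0 : 0 < 4 * (t + 1) by lra.
have th_gt0 : 0 < th by rewrite lt_min divr_gt0 // invr_gt0 ltr0n.
have th_le : th <= 2^-1 by rewrite ge_min lexx.
have th_e : th * (4 * (t + 1)) <= e.
  by rewrite -ler_pdivlMr // ge_min lexx orbT.
(* Multiplying the threshold by [theta] treats both tails at once, with [theta = th] and
   [theta = - th]. *)
have tail (theta g : R) (N : R -> {RV P >-> nat}) : a <= g ->
    poisson_process (g - a) N -> `|theta| = th ->
    (P (N t @^-1` [set n | theta * (g * t) + th * (e * g) <= theta * n%:R]%R) <=
      (expR (a * t) * expR (- (th * e / 2) * g))%:E)%E.
  move=> ag Npoisson theta_th.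
  have law := poisson_process_law Npoisson (lexx 0) t_ge0.
  set A := [set n | _]%R.
  have -> : N t @^-1` A = (fun w => (N t w - N 0%R w)%N) @^-1` A.
    by apply/seteqP; split=> w /=; rewrite (poisson_process0 Npoisson) subn0.
  rewrite law subr0.
  have theta_neq0 : theta != 0 by rewrite -normr_gt0 theta_th.
  pose x := g * t + theta^-1 * (th * (e * g)).
  have thetax : theta * x = theta * (g * t) + th * (e * g).
    by rewrite mulrDr mulrA mulVKf.
  apply: le_trans (@poisson_chernoff _ _ theta x _ _ _) _.
  - by rewrite mulr_ge0 // subr_ge0.
  - by move=> n; rewrite thetax.
  rewrite lee_fin thetax -expRD ler_expR.
  have := @expR_quadratic_bound _ theta; rewrite theta_th => /(_ th_le).
  have -> : theta ^+ 2 = th ^+ 2.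
    by rewrite -theta_th -normrX ger0_norm ?sqr_ge0.
  have := expR_gt0 theta.
  have : - th <= theta <= th by rewrite -ler_norml theta_th.
  set E := expR theta => thetaP E_gt0 E_le.
  have g_ge0 : 0 <= g by lra.
  have : (g - a) * t * (E - 1) <= (g - a) * t * (theta + 2 * th ^+ 2).
    rewrite ler_wpM2l ?mulr_ge0 //; lra.
  have : 0 <= a * t by rewrite mulr_ge0.
  have : 2 * (g * t * th ^+ 2) <= th * e / 2 * g.
    suff : 0 <= g * th * (e - th * (4 * t)) by nra.
    by rewrite !mulr_ge0 //; nra.
  by nra.
exists (th * e / 2) => [|g N ag Npoisson]; first by rewrite divr_gt0 ?mulr_gt0.
set B := fun theta : R =>
  N t @^-1` [set n | theta * (g * t) + th * (e * g) <= theta * n%:R]%R.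
have mN (A : set nat) : measurable (N t @^-1` A).
  by rewrite -[_ @^-1` _]setTI; exact: measurable_funP.
apply: (@le_trans _ _ (P (B th `|` B (- th)))).
  apply: le_measure; rewrite ?inE //.
  - exact: (mN [set n | e * g < `|n%:R - g * t|]%R).
  - by apply: measurableU; exact: mN.
  move=> w /=; rewrite lter_normr /B /= => /orP[] ?; [left|right]; nra.
apply: le_trans (measureU2 P (mN _) (mN _)) _.
apply: (@le_trans _ _ (_ + _)%E).
  by apply: leeD; apply: tail => //; rewrite ?normrN ger0_norm // ltW.
by rewrite -EFinD lee_fin -mulrA; lra.
Qed.

End poisson_deviation.

Section borel_cantelli.
Context {d : measure_display} {Om : measurableType d} {R : realType}.
Variable P : probability Om R.

(** The first Borel-Cantelli lemma, with a real summable majorant that fits the exponential bounds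
    above. *)
Lemma ae_eventually_not (F : nat -> set Om) (v : nat -> R) :
  (forall n, measurable (F n)) -> cvgn (series v) ->
  (forall n, (P (F n) <= (v n)%:E)%E) ->
  {ae P, forall w, \forall n \near \oo, ~ F n w}.
Proof.
move=> mF v_cvg F_le.
have F_lim0 : P (lim_sup_set F) = 0%E.
  apply: lim_sup_set_cvg0 => //.
  apply: (@le_lt_trans _ _ (\sum_(n <oo) (v n)%:E)%E).
    by apply: lee_nneseries => [n _ _|n _]; [exact: measure_ge0|exact: F_le].
  have -> : (\sum_(n <oo) (v n)%:E)%E = (limn (series v))%:E.
    by rewrite -EFin_lim //; apply/congr_lim/funext => n /=; rewrite sumEFin.
  exact: ltry.
exists (lim_sup_set F); split=> //.
  by apply: bigcap_measurable => // n _; exact: bigcup_measurable.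
move=> w /= not_ev n _; apply: contrapT => noF; apply: not_ev.
by exists n => // m /= nm Fm; apply: noF; exists m.
Qed.

End borel_cantelli.

(** * Uniformity in time and in the rate *)

Section law_of_large_numbers.
Context {R : realType}.

(** For [G i > 0] this is uniform convergence of [X i t / G i] to [t] on bounded intervals, with the
    denominator cleared. *)
Definition uniform_lln {I : Type} (F : set_system I) (X : I -> R -> nat)
    (G : I -> R) : Prop :=
  forall T e : R, 0 < e -> \forall i \near F, forall t, 0 <= t <= T ->
    `|(X i t)%:R - G i * t| <= e * G i.

(** By monotonicity, [X i t] lies between the values at the neighbouring grid points. Mesh and error
    at these points each contribute [1 / (m + 1)], in total at most [e]. *)
Lemma uniform_lln_of_grid {I : Type} (F : set_system I) {FF : Filter F}
    (X : I -> R -> nat) (G : I -> R) :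
  (\forall i \near F, 0 <= G i) ->
  (\forall i \near F, forall s t, 0 <= s -> s <= t -> (X i s <= X i t)%N) ->
  (forall k m : nat, \forall i \near F,
    `|(X i (k%:R / m.+1%:R))%:R - G i * (k%:R / m.+1%:R)|
      <= m.+1%:R^-1 * G i) ->
  uniform_lln F X G.
Proof.
move=> G_ge0 X_ndecr X_grid T e e_gt0.
pose m := Num.truncn (2 / e).
have m_gt0 : 0 < m.+1%:R :> R by rewrite ltr0n.
have m_e : 2 * m.+1%:R^-1 <= e.
  by rewrite ler_pdivrMr // mulrC -ler_pdivrMr // ltW //; exact: truncnS_gt.
pose p := (Num.truncn (T * m.+1%:R)).+2.
have X_grid_p : \forall i \near F, forall k : 'I_p,
    `|(X i (k%:R / m.+1%:R))%:R - G i * (k%:R / m.+1%:R)| <= m.+1%:R^-1 * G i.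
  by apply: filter_forall => k; exact: X_grid.
near=> i => t /andP[t_ge0 t_le].
have grid : forall j : 'I_p,
    `|(X i (j%:R / m.+1%:R))%:R - G i * (j%:R / m.+1%:R)| <= m.+1%:R^-1 * G i.
  by near: i.
have Gi : 0 <= G i by near: i.
have Xn : forall s u, 0 <= s -> s <= u -> (X i s <= X i u)%N by near: i.
have Xi s u : 0 <= s -> s <= u -> (X i s)%:R <= (X i u)%:R :> R.
  by rewrite ler_nat; exact: Xn.
pose k := Num.truncn (t * m.+1%:R).
have tm_ge0 : 0 <= t * m.+1%:R by rewrite mulr_ge0.
have k_le : k%:R / m.+1%:R <= t.
  by rewrite ler_pdivrMr // truncn_le.
have k_gt : t < k.+1%:R / m.+1%:R.
  by rewrite ltr_pdivlMr // truncnS_gt.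
have kp : (k.+1 < p)%N.
  by rewrite /p !ltnS le_truncn // ler_wpM2r.
have := grid (Ordinal kp); have := grid (Ordinal (ltnW kp)) => /=.
have := Xi _ _ (divr_ge0 (ler0n _ k) (ltW m_gt0)) k_le.
have := Xi _ _ t_ge0 (ltW k_gt).
move: k_le k_gt m_e; rewrite -[k.+1%:R]natr1 mulrDl mul1r.
set u := k%:R / _; set v := m.+1%:R^-1 => ut tuv ve.
rewrite !ler_norml => Xt Xu /andP[Xu1 Xu2] /andP[Xuv1 Xuv2].
have : G i * u <= G i * t by rewrite ler_wpM2l.
have : G i * t <= G i * (u + v) by rewrite ler_wpM2l // ltW.
have : G i * (2 * v) <= G i * e by rewrite ler_wpM2l.
by move: Xt Xu Xu1 Xu2 Xuv1 Xuv2; rewrite !mulrDr; lra.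
Unshelve. all: by end_near. Qed.

(** With [n] the integer part of [g - a], [X g] lies between [X (a + n)] and [X (a + n + 1)].
    Changing the scale by at most 1 costs at most [T + e / 2], which is below [e / 2 * g] for large
    [g]. *)
Lemma uniform_lln_real_scale (a : R) (X : R -> R -> nat) : 0 <= a ->
  (forall g g' t, a <= g -> g <= g' -> 0 <= t -> (X g t <= X g' t)%N) ->
  uniform_lln \oo (fun n : nat => X (a + n%:R)) (fun n => a + n%:R) ->
  uniform_lln (+oo : set_system R) X id.
Proof.
move=> a_ge0 X_ndecr X_lln T e e_gt0.
have e2_gt0 : 0 < e / 2 by rewrite divr_gt0.
have [n0 _ n0P] := X_lln T _ e2_gt0.
near=> g => t /andP[t_ge0 t_le].
have a_le : a + n0%:R <= g by near: g; apply: nbhs_pinfty_ge; exact: num_real.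
have T_le : 2 * (T + e / 2) / e <= g.
  by near: g; apply: nbhs_pinfty_ge; exact: num_real.
pose n := Num.truncn (g - a).
have ga_ge0 : 0 <= g - a by rewrite subr_ge0 (le_trans _ a_le) // lerDl.
have n_le : n%:R <= g - a by rewrite truncn_le.
have n_gt : g - a < n.+1%:R by rewrite truncnS_gt.
have n0n : (n0 <= n)%N by rewrite truncn_ge_nat //; lra.
have t_bound : 0 <= t <= T by rewrite t_ge0.
have := n0P n n0n t t_bound; have := n0P n.+1 (leqW n0n) t t_bound.
have : (X (a + n%:R) t)%:R <= (X g t)%:R :> R.
  by rewrite ler_nat X_ndecr // ?lerDl //; lra.
have : (X g t)%:R <= (X (a + n.+1%:R) t)%:R :> R.
  by rewrite ler_nat X_ndecr //; lra.
move: T_le; rewrite ler_pdivrMr // !ler_norml.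
have -> : a + n.+1%:R = a + n%:R + 1 by rewrite -natr1 addrA.
move: n_gt; rewrite -natr1; move: (n%:R : R) n_le => q q_le q_gt.
have qt1 : (a + q) * t <= g * t by rewrite ler_wpM2r //; lra.
have qt2 : (g - 1) * t <= (a + q) * t by rewrite ler_wpM2r //; lra.
have qe1 : e / 2 * (a + q) <= e / 2 * g by rewrite ler_wpM2l //; lra.
by move=> T_le X1 X2 /andP[X3 X4] /andP[X5 X6]; apply/andP; split; lra.
Unshelve. all: by end_near. Qed.

End law_of_large_numbers.

Section poisson_lln.
Context {d : measure_display} {Om : measurableType d} {R : realType}.
Variable P : probability Om R.

(** At each of the countably many grid times the deviation bounds are summable in [n], by the last
    hypothesis. *)
Lemma poisson_process_lln (a : R) (g : nat -> R)
    (N : nat -> R -> {RV P >-> nat}) : 0 <= a -> (forall n, a <= g n) ->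
  (forall n, poisson_process (g n - a) (N n)) ->
  (forall c, 0 < c -> cvgn (series (fun n => expR (- c * g n)))) ->
  {ae P, forall w, uniform_lln \oo (fun n t => N n t w) g}.
Proof.
move=> a_ge0 a_le Npoisson g_cvg.
have grid : {ae P, forall w, forall k m : nat, \forall n \near \oo,
    `|(N n (k%:R / m.+1%:R) w)%:R - g n * (k%:R / m.+1%:R)|
      <= m.+1%:R^-1 * g n}.
  apply: ae_foralln => k; apply: ae_foralln => m.
  have t_ge0 : 0 <= k%:R / m.+1%:R :> R by rewrite divr_ge0.
  have e_gt0 : 0 < m.+1%:R^-1 :> R by rewrite invr_gt0.
  have [c c_gt0 tail] := poisson_process_deviation P _ _ _ a_ge0 t_ge0 e_gt0.
  have /= ev := @ae_eventually_not _ _ _ P _ _ _ _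
    (fun n => tail _ _ (a_le n) (Npoisson n)).
  apply: filterS (ev _ _) => [w|n|].
  - by apply: filterS => n /negP; rewrite -leNgt.
  - rewrite -[X in measurable X]setTI.
    exact: (measurable_funP (N n _) measurableT
      [set j | m.+1%:R^-1 * g n < `|j%:R - g n * (k%:R / m.+1%:R)|]).
  - rewrite (_ : (fun n => _) = (2 * expR (a * (k%:R / m.+1%:R))) *:
      (fun n => expR (- c * g n)) :> (nat -> R^o)) //.
    exact: is_cvg_seriesZ (g_cvg _ c_gt0).
apply: filterS grid => w grid; apply: uniform_lln_of_grid => //.
- by apply: nearW => n; rewrite (le_trans a_ge0).
- by apply: nearW => n s t; exact: (poisson_process_ndecr (Npoisson n)).
Qed.

End poisson_lln.

(** * Convergence of the approximation *)

Section arrival_clock.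
Context {R : realType}.
Implicit Types (M Nh : R -> nat) (s t : R).

Lemma arrival_ge0 M n : 0 <= arrival M n.
Proof.
rewrite /arrival; set A := [set t | _].
have [A_neq0|A0] := pselect (A !=set0); first by apply: lb_le_inf => // t [].
rewrite (_ : A = set0) ?inf0 //; apply/seteqP; split=> // t At.
by case: A0; exists t.
Qed.

Lemma le_arrival M m n t : (m <= n)%N -> 0 <= t -> (n <= M t)%N ->
  arrival M m <= arrival M n.
Proof.
move=> mn t_ge0 nt; apply: lb_le_inf => [|s [s_ge0 ns]]; first by exists t.
by apply: ge_inf; [exists 0 => u []|split=> //; exact: leq_trans ns].
Qed.

(** Both counts are within [del / 3 * g] of [g * t], so the grid reaches level [Nh t] by time
    [t + del] and not before [t - del]. *)
Lemma arrival_clock_near M Nh (g T del : R) : 0 < g -> 0 < del ->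
  (forall t, 0 <= t <= T + del -> `|(M t)%:R - g * t| <= del / 3 * g) ->
  (forall t, 0 <= t <= T -> `|(Nh t)%:R - g * t| <= del / 3 * g) ->
  forall t, 0 <= t <= T ->
    (Nh t <= M (t + del)%R)%N /\ `|arrival M (Nh t) - t| <= del.
Proof.
move=> g_gt0 del_gt0 M_near Nh_near t /andP[t_ge0 t_le].
have t_bound : 0 <= t <= T by rewrite t_ge0.
have td_ge0 : 0 <= t + del by lra.
have gdel : 0 < g * del by rewrite mulr_gt0.
have reach : (Nh t <= M (t + del)%R)%N.
  rewrite -(ler_nat R); have := M_near (t + del); rewrite td_ge0 lerD2r t_le.
  move=> /(_ isT); have := Nh_near t t_bound; rewrite !ler_norml mulrDr.
  by move=> /andP[? ?] /andP[? ?]; lra.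
split=> //; rewrite ler_norml; apply/andP; split.
  rewrite lerBrDr addrC; apply: lb_le_inf; first by exists (t + del).
  move=> s [s_ge0]; rewrite -(ler_nat R) => Nh_le.
  rewrite leNgt; apply/negP => s_lt.
  have := M_near s; rewrite s_ge0 (_ : s <= T + del) /=; last by lra.
  move=> /(_ isT); have := Nh_near t t_bound; rewrite !ler_norml.
  have : g * s < g * (t - del) by rewrite ltr_pM2l.
  by rewrite mulrBr => ? /andP[? ?] /andP[? ?]; lra.
rewrite lerBlDl; apply: ge_inf; first by exists 0 => s [].
by split.
Qed.

End arrival_clock.

(** The pathwise core; the general filter covers both a real parameter and a sequence of rates. *)
Lemma J1_cvg_of_lln {R : realType} {J : nat} {I : Type} (F : set_system I)
    {FF : Filter F} (c : R -> nat) (f : nat -> 'I_J) (N' Nhat : I -> R -> nat)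
    (G : I -> R) : counting_path c -> G i @[i --> F] --> +oo ->
  (\forall i \near F, counting_path (Nhat i)) ->
  uniform_lln F N' G -> uniform_lln F Nhat G ->
  J1_cvg (with_duration
      (approx_path (f \o c) (fun s => c s + N' i s)%N (Nhat i)) @[i --> F])
    (with_duration (f \o c)).
Proof.
move=> c_counting G_oo Nhat_counting N'_lln Nhat_lln.
split; first exact: with_duration_cadlag.
move=> A [[T' e] /= e_gt0 ball_A].
pose T := Num.max T' 0; have T_ge0 : 0 <= T by rewrite le_max lexx orbT.
(* Durations move by at most twice the displacement of the time change, and [2 * (e / 3) < e]. *)
have e3_gt0 : 0 < e / 3 by rewrite divr_gt0.
have [del del_gt0 match_del] :=
  counting_path_match c T (e / 3) c_counting T_ge0 e3_gt0.
have del3_gt0 : 0 < del / 3 by rewrite divr_gt0.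
have del6_gt0 : 0 < del / 6 by rewrite divr_gt0.
pose T3 := T + 3.
near=> i; apply: ball_A => /=.
have G_gt0 : 0 < G i by near: i; apply: (cvgryPgt _).1.
(* The fixed path [c] becomes negligible at scale [G i]: its count and the error of [N' i] take
   [del / 6] each, [del / 3] together. *)
have G_c : (c (T3 + del))%:R / (del / 6) <= G i.
  by near: i; apply: (cvgryPge _).1.
have Nhati : counting_path (Nhat i) by near: i.
pose M s := (c s + N' i s)%N.
pose a s := arrival M (Nhat i s).
have M_near t : 0 <= t <= T3 + del -> `|(M t)%:R - G i * t| <= del / 3 * G i.
  move=> t_bound.
  have N'_near : `|(N' i t)%:R - G i * t| <= del / 6 * G i.
    by move: t t_bound; near: i; exact: N'_lln.
  have c_le : (c t)%:R <= del / 6 * G i.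
    rewrite mulrC -ler_pdivrMr // (le_trans _ G_c) //.
    rewrite ler_wpM2r ?invr_ge0 ?(ltW del6_gt0) // ler_nat.
    by case/andP: t_bound => t_ge0 t_le; exact: c_counting.1.
  move: N'_near c_le (ler0n R (c t)); rewrite /M natrD !ler_norml.
  by move=> /andP[? ?] ? ?; apply/andP; split; lra.
have Nhat_near t : 0 <= t <= T3 -> `|(Nhat i t)%:R - G i * t| <= del / 3 * G i.
  by move: t; near: i; exact: Nhat_lln.
have clock :=
  arrival_clock_near M (Nhat i) (G i) T3 del G_gt0 del_gt0 M_near Nhat_near.
have [||||lam [lam_tc lam_near c_lam]] := match_del a.
(* Unreached levels would have arrival time 0 by default; [clock] ensures that the higher level is
   reached. *)
- move=> s t s_ge0 st tT; have t_ge0 := le_trans s_ge0 st.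
  have [reach _] := clock t (introT andP (conj t_ge0 tT)).
  apply: le_arrival reach; first exact: Nhati.1.
  by rewrite addr_ge0 // ltW.
- exact: (right_constant_comp (arrival M) _ Nhati.2).
- by move=> t _; exact: arrival_ge0.
- by move=> t /clock[].
have path_lam t : 0 <= t <= T ->
    approx_path (f \o c) M (Nhat i) (lam t) = (f \o c) t.
  by move=> /c_lam; rewrite /approx_path /= -/(a (lam t)) => ->.
split.
  (* The approximation is itself a function of the counting path [Nhat i]. *)
  exact: (with_duration_cadlag (Nhat i) (f \o c \o arrival M) Nhati).
exists lam; split=> //.
  by move=> t /lam_near /lt_trans; apply; lra.
move=> t /andP[t_ge0 t_le].
have t_bound : 0 <= t <= T by rewrite t_ge0 le_max t_le.
split => /=; first by rewrite path_lam //; exact: ball_center.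
have lam_le s : 0 <= s -> `|lam s - s| <= e / 3 by move=> /lam_near/ltW.
rewrite /ball /=; apply: le_lt_trans
  (duration_time_change _ _ lam T _ lam_tc lam_le path_lam t t_bound) _.
by lra.
Unshelve. all: by end_near. Qed.

(** * From Poisson processes to almost sure convergence *)

Lemma poisson_process_counting_path {d : measure_display}
    {Om : measurableType d} {R : realType} (P : probability Om R) (rate : R)
    (N : R -> {RV P >-> nat}) (w : Om) :
  poisson_process rate N -> counting_path (fun s => N s w).
Proof.
move=> Npoisson; split=> [s t|s s_ge0].
  exact: (poisson_process_ndecr Npoisson).
have N_right := @poisson_process_right_cont _ _ _ _ _ _ Npoisson w s s_ge0.
have /discrete_cvg[e /= e_gt0 se] := N_right.
exists e => // t /andP[]; rewrite le_eqVlt => /predU1P[<- //|st t_lt].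
by apply: se => //=; rewrite ltr0_norm ?subr_lt0 // opprB ltrBlDl.
Qed.

Lemma is_cvg_series_expR_shift {R : realType} (a c : R) : 0 < c ->
  cvgn (series (fun n : nat => expR (- c * (a + n%:R)))).
Proof.
move=> c_gt0.
have -> : (fun n : nat => expR (- c * (a + n%:R))) =
    geometric (expR (- c * a)) (expR (- c)).
  by apply/funext => n; rewrite /geometric /= -expRM_natr -expRD mulrDr.
apply: is_cvg_geometric_series.
by rewrite ger0_norm ?expR_ge0 // expR_lt1 oppr_lt0.
Qed.

(** The laws are prescribed for each rate separately, not jointly across rates. Hence two forms of
    the limit: along real rates for a coupling monotone in the rate, and along sequences growing
    fast enough for Borel-Cantelli under any coupling. *)
Theorem theorem3p2 (R : realType) (d : measure_display) (Om : measurableType d)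
  (P : probability Om R) (J : nat) (Lam : R -> R -> 'M[R]_J) (gamma0 : R)
  (i : 'I_J)
  (Gamma0 : R -> {RV P >-> nat}) (Y : nat -> {RV P >-> R})
  (Gamma' Gammahat : R -> R -> {RV P >-> nat})
  (gamma0_gt0 : 0 < gamma0)
  (Lam_intensity : forall s v, 0 <= s -> 0 <= v -> intensity_matrix (Lam s v))
  (Lam_cadlag1 : forall v, 0 <= v -> cadlag (fun s => Lam s v))
  (Lam_cadlag2 : forall s, 0 <= s -> cadlag (fun v => Lam s v))
  (Lam_bound : forall s v j, 0 <= s -> 0 <= v -> `|Lam s v j j| <= gamma0)
  (Gamma0_poisson : poisson_process gamma0 Gamma0)
  (Y_unif : forall n A, measurable A ->
     distribution P (Y n) A = uniform_prob (@ltr01 R) A)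
  (Y_indep : mutually_independent P (fun n => Y n : Om -> R))
  (Gamma0_Y_indep : independent_systems P
     (sigma_of [set t | 0 <= t] (fun t => Gamma0 t : Om -> nat))
     (sigma_of setT (fun n => Y n : Om -> R)))
  (Gamma'_poisson : forall g, gamma0 <= g ->
     poisson_process (g - gamma0) (Gamma' g))
  (Gamma'_indep : forall g, gamma0 <= g -> independent_systems P
     (sigma_of [set t | 0 <= t] (fun t => Gamma' g t : Om -> nat))
     <<s sigma_of [set t | 0 <= t] (fun t => Gamma0 t : Om -> nat) `|`
         sigma_of setT (fun n => Y n : Om -> R) >>)
  (Gammahat_poisson : forall g, gamma0 <= g -> poisson_process g (Gammahat g))
  (Gammahat_indep : forall g, gamma0 <= g -> independent_systems P
     (sigma_of [set t | 0 <= t] (fun t => Gammahat g t : Om -> nat))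
     <<s sigma_of [set t | 0 <= t] (fun t => Gamma0 t : Om -> nat) `|`
         sigma_of [set t | 0 <= t] (fun t => Gamma' g t : Om -> nat) `|`
         sigma_of setT (fun n => Y n : Om -> R) >>) :
  let Z w := sm_path Lam gamma0 i (fun s => Gamma0 s w) (fun n => Y n w) in
  let Zhat g w := approx_path (Z w)
    (fun s => Gamma0 s w + Gamma' g s w)%N (fun s => Gammahat g s w) in
  ({ae P, forall w, forall g g' t, gamma0 <= g -> g <= g' -> 0 <= t ->
      (Gamma' g t w <= Gamma' g' t w)%N /\
      (Gammahat g t w <= Gammahat g' t w)%N} ->
   {ae P, forall w,
      J1_cvg (with_duration (Zhat g w) @[g --> +oo]) (with_duration (Z w))}) /\
  (forall g : nat -> R, (forall n, gamma0 <= g n) ->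
   (forall c, 0 < c -> cvgn (series (fun n => expR (- c * g n)))) ->
   {ae P, forall w,
      J1_cvg (with_duration (Zhat (g n) w) @[n --> \oo])
        (with_duration (Z w))}).
Proof.
move=> Z Zhat.
have gamma0_ge0 := ltW gamma0_gt0.
have Gammahat_counting g w : gamma0 <= g ->
    counting_path (fun s => Gammahat g s w).
  by move=> /Gammahat_poisson/poisson_process_counting_path; exact.
have Gamma0_counting w : counting_path (fun s => Gamma0 s w).
  exact: poisson_process_counting_path Gamma0_poisson.
(* The state after [n] arrivals, so that [Z w] is [f w] composed with the path of [Gamma0]. *)
pose f w n := (sm_chain Lam gamma0 i (arrival (fun s => Gamma0 s w))
  (fun n => Y n w) n).1.
have lln (g : nat -> R) : (forall n, gamma0 <= g n) ->
    (forall c, 0 < c -> cvgn (series (fun n => expR (- c * g n)))) ->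
    {ae P, forall w, uniform_lln \oo (fun n t => Gamma' (g n) t w) g /\
      uniform_lln \oo (fun n t => Gammahat (g n) t w) g}.
  move=> g_ge g_cvg.
  have ae' := poisson_process_lln P gamma0 g (fun n => Gamma' (g n)) gamma0_ge0
    g_ge (fun n => Gamma'_poisson _ (g_ge n)) g_cvg.
  have rate_hat n : poisson_process (g n - 0) (Gammahat (g n)).
    by rewrite subr0; exact: Gammahat_poisson.
  have aehat := poisson_process_lln P 0 g (fun n => Gammahat (g n)) (lexx 0)
    (fun n => le_trans gamma0_ge0 (g_ge n)) rate_hat g_cvg.
  exact: filterS2 ae' aehat.
split=> [mono|g g_ge g_cvg].
  (* These rates give convergent geometric series; monotonicity then fills the gaps between them. *)
  pose g n : R := gamma0 + n%:R.
  have g_ge n : gamma0 <= g n by rewrite lerDl.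
  have g_cvg c : 0 < c -> cvgn (series (fun n => expR (- c * g n))).
    exact: is_cvg_series_expR_shift.
  apply: filterS2 mono (lln g g_ge g_cvg) => w w_mono [lln' llnhat].
  have near_ge : \forall h \near (+oo : set_system R), gamma0 <= h.
    by apply: nbhs_pinfty_ge; exact: num_real.
  apply: (J1_cvg_of_lln _ (fun s => Gamma0 s w) (f w)
    (fun h s => Gamma' h s w) (fun h s => Gammahat h s w) id) => //.
  - by apply: filterS near_ge => h /Gammahat_counting.
  - apply: uniform_lln_real_scale gamma0_ge0 _ lln' => h h' t h_ge hh' t_ge0.
    by have [] := w_mono h h' t h_ge hh' t_ge0.
  - apply: uniform_lln_real_scale gamma0_ge0 _ llnhat => h h' t h_ge hh' t_ge0.
    by have [] := w_mono h h' t h_ge hh' t_ge0.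
apply: filterS (lln g g_ge g_cvg) => w [lln' llnhat].
apply: (J1_cvg_of_lln _ (fun s => Gamma0 s w) (f w)
  (fun n s => Gamma' (g n) s w) (fun n s => Gammahat (g n) s w) g) => //.
(* Summability with [c = 1] forces [expR (- g n)] to tend to 0, hence [g n] to infinity. *)
- apply/cvgryPge => A.
  have /cvg_series_cvg_0/cvgrPdist_lt := g_cvg 1 ltr01.
  move=> /(_ _ (expR_gt0 (- A))); apply: filterS => n.
  rewrite sub0r normrN ger0_norm ?expR_ge0 // ltr_expR mulN1r ltrN2.
  exact: ltW.
- by apply: nearW => n; exact: Gammahat_counting.
Qed.
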